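(* If $f\colon\mathbb{R}\to\mathbb{R}$ is a continuous topologically transitive map, then $\operatorname{ent}(f)>\log\sqrt{3}$.
   Context: A continuous map $f\colon X\to X$ of a metric space is (topologically) transitive if for all nonempty open $U,V\subset X$ there is a positive integer $n$ with $f^n(U)\cap V\neq\emptyset$. For a compact set $K\subset X$ with $f(K)\subset K$, $h(f|_K)\in[0,+\infty]$ denotes the usual topological entropy of $f|_K\colon K\to K$ (natural logarithm). The Cánovas–Rodríguez entropy is $\operatorname{ent}(f)=\sup\{h(f|_K) : K\subset X \text{ nonempty, compact, } f(K)\subset K\}$, with the convention $\operatorname{ent}(f)=\infty$ if there is no such $K$. *)

(* Defs.v *)
From HB Require Import structures.
From mathcomp Require Import all_boot all_order all_algebra finmap.
From mathcomp Require Import all_classical all_reals all_analysis.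
Set Implicit Arguments.
Unset Strict Implicit.
Unset Printing Implicit Defensive.
Import Order.TTheory GRing.Theory Num.Theory.
Import numFieldNormedType.Exports.
Local Open Scope classical_set_scope.
Local Open Scope ring_scope.

(* The library makes only R^o a metric space; the distance is
   mdist x y = `|y - x|. *)
HB.instance Definition _ (R : realType) := Metric.copy R R^o.

Section Dynamics.
Context {R : realType} {X : metricType R}.
Implicit Types (f : X -> X) (K : set X) (E : {fset X}) (n : nat) (e : R).

Definition transitive_map f : Prop :=
  forall U V : set X, open U -> open V -> U !=set0 -> V !=set0 ->
    exists2 n, (0 < n)%N & (iter n f @` U) `&` V !=set0.

Definition separated_in K f n e E : Prop :=
  [set` E] `<=` K /\
  forall x y, x \in E -> y \in E -> x != y ->
    exists2 i, (i < n)%N & e < mdist (iter i f x) (iter i f y).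

(* Maximal cardinality of an (n, e)-separated subset of K; it is finite when
   K is compact and f is continuous, but the definition does not rely on it. *)
Definition sep_number K f n e : \bar R :=
  ereal_sup [set (#|` E|%:R)%:E | E in separated_in K f n e].

Definition sep_growth K f e : \bar R :=
  limn_esup (fun n => ((n%:R^-1)%:E * lne (sep_number K f n e))%E).

(* Bowen's topological entropy h(f|_K), for K compact and f-invariant.  As K
   is invariant, the iterates of f|_K are the restrictions of those of f.
   The limit exists: see htopE. *)
Definition htop K f : \bar R := lim (sep_growth K f e @[e --> 0^'+]).

Lemma sep_growth_nonincreasing K f e1 e2 : e1 <= e2 ->
  (sep_growth K f e2 <= sep_growth K f e1)%E.
Proof.
move=> e12; rewrite /sep_growth /limn_esup !limf_esupE.
have H n : (sep_number K f n e2 <= sep_number K f n e1)%E.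
  apply: le_ereal_sup => _ [E [EK sE] <-]; exists E => //; split => // x y xE yE xy.
  by have [i ilt lt] := sE x y xE yE xy; exists i => //; apply: le_lt_trans lt.
have P n e : (0 <= sep_number K f n e)%E.
  apply: ereal_sup_ubound; exists fset0%fset; last by rewrite cardfs0.
  by split => // x y; rewrite in_fset0.
apply: le_ereal_inf_tmp => _ [V Vn <-].
apply: (@le_trans _ _ (ereal_sup [set ((n%:R^-1)%:E * lne (sep_number K f n e2))%E | n in V])).
  by apply: ereal_inf_lbound; exists V.
apply: ge_ereal_sup => _ [n Vx <-].
apply: le_trans; last by apply: ereal_sup_ubound; exists n; [exact: Vx|reflexivity].
apply: lee_wpmul2l; first by rewrite lee_fin invr_ge0.
by rewrite lee_lne// in_itv/= leey P.
Qed.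

Lemma htopE K f :
  htop K f = ereal_sup [set sep_growth K f e | e in [set e | 0 < e]].
Proof.
rewrite /htop.
have := @nonincreasing_at_right_cvge R (sep_growth K f) 0 +oo%O isT.
move=> /(_ _)/cvg_lim ->//; last by move=> x y _ _; exact: sep_growth_nonincreasing.
by congr (ereal_sup _); apply/seteqP; split => _ [e e0 <-]; exists e => //; move: e0; rewrite /= in_itv/= andbT.
Qed.

Definition invariant_compacts f : set (set X) :=
  [set K | [/\ K !=set0, compact K & f @` K `<=` K]].

Definition ent f : \bar R :=
  if `[< invariant_compacts f !=set0 >]
  then ereal_sup [set htop K f | K in invariant_compacts f]
  else +oo%E.

End Dynamics.

(* Main.v *)
(* A compact set split into N disjoint compact pieces, each mapped over the whole
   set by f^m, forces ent f >= ln N / m; so it suffices to find such a horseshoe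
   with N^2 > 3^m.  A transitive map has no proper closed invariant set with
   nonempty interior.  If f moves points to the right on some interval ]p, z]
   starting at a fixed point p, then [p, y], where y is the first later point
   with f y = p, is not invariant, and this gives a 2-horseshoe for f.
   Otherwise f has a fixed point c with f t <= t on the right of c and t <= f t
   on its left.  Then cut f off at c so that it exchanges the two half-lines
   ]-oo, c] and [c, +oo[; the square g of the resulting map leaves no segment
   [c, M] and no ray [M, +oo[ with M > c invariant.  Choosing maxima of g
   suitably gives c < p < x < y < q with g p = p, g x >= q, g y = p, g q = q, so
   g has three laps over [p, q].  As [p, q] is not invariant, some part of it, not
   needed for these laps, leaves [p, q] through p or q; by transitivity its
   iterates come back and cover [p, q].  Since g coincides with f^2 wherever
   g > c, all these coverings hold for f^2, and the additional return makes the
   growth rate for f^2 strictly larger than 3. *)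
Require Import Defs.
From HB Require Import structures.
From mathcomp Require Import all_boot all_order all_algebra finmap.
From mathcomp Require Import all_classical all_reals all_analysis.
From mathcomp Require Import ring lra zify.
Import Order.TTheory GRing.Theory Num.Theory.
Import numFieldNormedType.Exports.
Local Open Scope classical_set_scope.
Local Open Scope ring_scope.

(** * Entropy of horseshoes *)

Section Entropy.
Context {R : realType}.
Implicit Types (f : R -> R) (S K : set R).

Lemma continuous_iter f n : continuous f -> continuous (iter n f).
Proof.
move=> fc; elim: n => [|n IH] x /=; first exact: cvg_id.
by apply: continuous_comp; [exact: IH | exact: fc].
Qed.

Lemma compact_disjoint_gap (A : finType) (C : A -> set R) :
  (forall a, compact (C a)) ->
  (forall a b, a != b -> C a `&` C b = set0) ->
  exists2 d : R, 0 < d &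
    forall a b x y, a != b -> C a x -> C b y -> d < `|y - x|.
Proof.
move=> Cc Cd.
suff: \forall d \near (0:R)^'+, forall ab : A * A, ab.1 != ab.2 ->
    forall x, C ab.1 x -> forall y, C ab.2 y -> d < `|y - x|.
  move=> Hd; have [d [d0 Hab]] : exists d : R, 0 < d /\
      forall ab : A * A, ab.1 != ab.2 ->
      forall x, C ab.1 x -> forall y, C ab.2 y -> d < `|y - x|.
    apply: (@filter_ex _ (0:R)^'+); apply: filterI Hd; exact: nbhs_right_gt.
  by exists d => // a b x y ab ax bY; exact: (Hab (a, b)).
apply: filter_forall => -[a b] /=; have [->|ab] := eqVneq a b.
  by near=> d.
suff: \forall d \near (0:R)^'+,
    C a `<=` [set x | forall y, C b y -> d < `|y - x|].
  by apply: filterS => d H _ x ax y bY; exact: H.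
have /compact_near_coveringP := Cc a; apply => x ax.
have xb : (~` C b) x by move=> bx; have : (C a `&` C b) x by []; rewrite Cd.
have : open (~` C b).
  by apply: closed_openC; apply: compact_closed => //; exact: Rhausdorff.
rewrite openE => /(_ _ xb) /nbhs_ballP[r /= r0 rb].
have r2 : 0 < r / 2 by lra.
near=> x' d => y bY.
have xr : `|x - x'| < r / 2 by near: x'; exact: (nbhsx_ballx x _ r2).
have dr : d < r / 2 by near: d; exact: nbhs_right_lt.
have : r <= `|x - y| by rewrite leNgt; apply/negP => ?; exact: (rb y).
have := ler_distD x' x y; rewrite (distrC y x') /=; lra.
Unshelve. all: by end_near. Qed.


(* The periodic point [s] closes finite itineraries into bounded full orbits. *)
Definition horseshoe f m N := exists (A : finType) (C : A -> set R) S (s : R),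
  [/\ #|A| = N,
      forall a, [/\ compact (C a), C a `<=` S & S `<=` iter m f @` C a],
      forall a b, a != b -> C a `&` C b = set0 &
      [/\ compact S, S s & iter m f s = s]].

(** Since the growth is a limit superior, times that are multiples of [m] suffice: every tail
    contains some [m * n.+1], where the successor keeps the time nonzero. *)
Lemma sep_growth_ge K f e m (L : R) : (0 < m)%N ->
  (forall n, (expR (L * n%:R))%:E <= sep_number K f (m * n) e)%E ->
  ((L / m%:R)%:E <= sep_growth K f e)%E.
Proof.
move=> m0 HL; rewrite /sep_growth /limn_esup limf_esupE.
apply: le_ereal_inf_tmp => _ [V [n _ nV] <-].
apply: (@le_trans _ _ (((m * n.+1)%:R^-1)%:E *
    lne (sep_number K f (m * n.+1) e))%E); last first.
  apply: ereal_sup_ubound; exists (m * n.+1)%N => //; apply: nV => /=.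
  by rewrite (leq_trans (leqnSn n))// leq_pmull.
apply: (@le_trans _ _ (((m * n.+1)%:R^-1)%:E * (L * n.+1%:R)%:E)%E).
  rewrite -EFinM lee_fin natrM.
  have m0' : (m%:R : R) != 0 by rewrite pnatr_eq0 -lt0n.
  have n0' : (n.+1%:R : R) != 0 by rewrite pnatr_eq0.
  rewrite le_eqVlt; apply/orP; left; apply/eqP; field.
  by rewrite ?m0' ?natr1 ?n0' ?andbT.
apply: lee_wpmul2l; first by rewrite lee_fin invr_ge0.
have -> : (L * n.+1%:R)%:E = lne (expR (L * n.+1%:R))%:E.
  by rewrite lne_EFin ?expR_gt0// expRK.
rewrite lee_lne ?in_itv /= ?leey ?andbT ?lee_fin ?expR_ge0 //.
by apply: le_trans (HL n.+1); rewrite lee_fin expR_ge0.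
Qed.

(** Choosing inverse branches [g a] of [iter m f] on [S] and pulling [s] back along a word [w] gives
    a point [x w] on which [iter m f] deletes the first letter. An exhausted word stays at [s], so
    whole orbits obey one bound [M], and the points with orbit bounded by [M] form an invariant
    compact [K]. The words of length [n] give [N ^ n] separated points of [K]. *)
Lemma horseshoe_ent f m N : continuous f -> (0 < m)%N -> (0 < N)%N ->
  horseshoe f m N -> ((ln N%:R / m%:R)%:E <= ent f)%E.
Proof.
move=> fc m0 N0 [A [C [S [s [cA CS Cd [Sc Ss fs]]]]]].
have Cc a : compact (C a) by have [] := CS a.
have [d d0 gap] := compact_disjoint_gap A C Cc Cd.
have [g gP] : {g : A -> R -> R & forall a t, S t ->
    C a (g a t) /\ iter m f (g a t) = t}.
  have H a t : exists u, S t -> C a u /\ iter m f u = t.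
    have [St|nSt] := pselect (S t); last by exists 0.
    by have [_ _ /(_ _ St) [u Cu ut]] := CS a; exists u.
  exists (fun a t => projT1 (cid (H a t))) => a t.
  exact: (projT2 (cid (H a t))).
pose x (w : seq A) := foldr g s w.
have xS w : S (x w).
  by elim: w => [//|a w IH] /=; have [_ + _] := CS a; apply; have [] := gP a _ IH.
have xC a w : C a (x (a :: w)) by have [] := gP a _ (xS w).
have xf w : iter m f (x w) = x (behead w).
  by case: w => [//|a w] /=; have [] := gP a _ (xS w).
have xdrop j w : iter (m * j) f (x w) = x (drop j w).
  elim: j w => [|j IH] w; first by rewrite muln0 drop0.
  by rewrite mulnS addnC iterD xf IH -drop1 drop_drop addn1.
have [M HM] : exists M, forall i t, (i < m)%N -> S t -> `|iter i f t| <= M.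
  elim: {1}m => [|k [M HM]]; first by exists 0.
  have /compact_bounded [M' [_ /(_ (M' + 1))]] : compact (iter k f @` S).
    apply: continuous_compact => //.
    by apply: continuous_subspaceT; exact: continuous_iter.
  move=> /(_ ltac:(lra)) HM'; exists (Num.max M (M' + 1)) => i t.
  rewrite ltnS leq_eqVlt le_max => /orP[/eqP ->|ik] St; apply/orP.
    by right; apply: HM'; exists t.
  by left; exact: HM.
pose K := [set t | forall n, `|iter n f t| <= M].
have xK w : K (x w).
  move=> n; elim/ltn_ind: n w => n IH w.
  have [nm|mn] := ltnP n m; first exact: HM.
  rewrite -(subnK mn) iterD xf; apply: IH.
  by rewrite -{2}(subn0 n) ltn_sub2l// (leq_trans m0).
have Kc : compact K.
  apply: (@subclosed_compact _ _ `[-M, M]); last 1 first.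
  - by move=> t /(_ 0%N) /=; rewrite in_itv/= ler_norml.
  - have -> : K = \bigcap_n ((fun t => `|iter n f t|) @^-1` [set u | u <= M]).
      by apply/seteqP; split => t Kt n; [move=> _; exact: Kt|exact: Kt].
    apply: closed_bigI => n _; apply: preimage_closed; last exact: closed_le.
    by move=> t _; apply: cvg_norm; exact: continuous_iter.
  - exact: segment_compact.
have Kinv : invariant_compacts f K.
  split => //; first by exists s; exact: (xK [::]).
  by move=> _ [t Kt <-] n; rewrite -iterSr.
rewrite /ent; case: asboolP => [_|[]]; last by exists K.
apply: (@le_trans _ _ (htop K f)); last by apply: ereal_sup_ubound; exists K.
rewrite htopE; apply: (@le_trans _ _ (sep_growth K f d)); last first.
  by apply: ereal_sup_ubound; exists d.
apply: sep_growth_ge => // n.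
have sep (v w : n.-tuple A) : v != w ->
    exists2 i, (i < m * n)%N & d < `|iter i f (x w) - iter i f (x v)|.
  move=> vw; have [j vwj] : exists j, tnth v j != tnth w j.
    apply/existsP; rewrite -negb_forall; apply: contra vw => /forallP H.
    by apply/eqP/eq_from_tnth => j; apply/eqP.
  exists (m * j)%N; first by rewrite ltn_pmul2l.
  have D (u : n.-tuple A) : drop j u = tnth u j :: drop j.+1 u.
    by rewrite (drop_nth (tnth u j)) ?size_tuple// -tnth_nth.
  by rewrite !xdrop !D; exact: (gap _ _ _ _ vwj).
have xinj : injective (x \o @tval n A).
  move=> v w /= vw; apply/eqP; apply: contraT => /sep[i _].
  by rewrite vw subrr normr0 ltNge (ltW d0).
apply: ereal_sup_ubound.
exists [fset (x \o @tval n A) w | w in {: n.-tuple A}]%fset.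
  split => [_ /imfsetP[w _ ->]|]; first exact: xK.
  move=> _ _ /imfsetP[v _ ->] /imfsetP[w _ ->] vw.
  by apply: sep; apply: contra_neq vw => ->.
rewrite card_imfset//= -cardE card_tuple cA.
by rewrite natrX mulrC expRM_natl lnK// posrE ltr0n.
Qed.

Lemma log_sqrt3_lt_ent f m N : continuous f -> (0 < m)%N ->
  (3 ^ m < N ^ 2)%N -> horseshoe f m N ->
  ((ln (Num.sqrt 3))%:E < ent f)%E.
Proof.
move=> fc m0 mN hf.
have N0 : (0 < N)%N by case: N mN {hf} => //; rewrite ltn0.
apply: lt_le_trans (horseshoe_ent _ _ _ fc m0 N0 hf); rewrite lte_fin.
rewrite ltr_pdivlMr ?ltr0n//.
have s3 : 0 < Num.sqrt 3 :> R by rewrite sqrtr_gt0.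
rewrite mulrC mulr_natl -lnXn// ltr_ln ?posrE ?exprn_gt0 ?ltr0n//.
rewrite -(@ltr_pXn2r _ 2) ?nnegrE ?exprn_ge0 ?sqrtr_ge0 ?ler0n//.
by rewrite exprAC sqr_sqrtr// -!natrX ltr_nat.
Qed.
End Entropy.

(** * Concatenation of coverings *)

Section Chains.
Context {R : realType} (h : R -> R).
Hypothesis hc : continuous h.
Implicit Types (S E T : set R).

(* Unlike in a horseshoe the pieces may touch, as consecutive laps do, but only
   at points sent to [E], in practice the two endpoints of [S]. *)
Definition covering_family S E T m N := exists (A : finType) (C : A -> set R),
  [/\ #|A| = N,
      forall a, [/\ compact (C a), C a `<=` T & S `<=` iter m h @` C a] &
      forall a b, a != b -> iter m h @` (C a `&` C b) `<=` E].

Lemma iter_stable E n : h @` E `<=` E -> iter n h @` E `<=` E.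
Proof.
move=> hE; elim: n => [|n IH] _ [x Ex <-] //=.
by apply: hE; exists (iter n h x) => //; apply: IH; exists x.
Qed.

Lemma compactI_preimage_iter (C D : set R) n :
  compact C -> compact D -> compact (C `&` iter n h @^-1` D).
Proof.
move=> Cc Dc; apply: compact_closedI => //; apply: preimage_closed.
  by move=> x _; exact: continuous_iter.
by apply: compact_closed => //; exact: Rhausdorff.
Qed.

(** The pieces are two-stage itineraries. If the first letters differ, a common point is in [E] at
    time [m] and stays there by invariance; otherwise the second letters differ. *)
Lemma covering_familyM S E T m n N P : h @` E `<=` E -> T `<=` S ->
  covering_family S E T m N -> covering_family S E T n P ->
  covering_family S E T (n + m) (N * P).
Proof.
move=> hE TS [A [C [cA CS Cd]]] [B [D [cB DS Dd]]].
exists (A * B)%type, (fun ab => C ab.1 `&` iter m h @^-1` D ab.2).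
split=> [|[a b]|[a b] [a' b']] /=; first by rewrite card_prod cA cB.
  have [Cc CT SC] := CS a; have [Dc DT SD] := DS b; split.
  - exact: compactI_preimage_iter.
  - by move=> x [/CT].
  - move=> y /SD[z Dz <-]; have [x Cx xz] := SC _ (TS _ (DT _ Dz)).
    by exists x; [split; rewrite //= xz|rewrite iterD xz].
move=> ab _ [x [[/= Cx Dx] [/= Cx' Dx']] <-]; rewrite iterD.
have [aa|aa] := eqVneq a a'.
  have bb : b != b' by apply: contra_neq ab => ->; rewrite aa.
  by apply: (Dd _ _ bb); exists (iter m h x).
apply: iter_stable => //; exists (iter m h x) => //.
by apply: (Cd _ _ aa); exists x.
Qed.

Lemma covering_familyX S E T m N r : h @` E `<=` E -> T `<=` S ->
  covering_family S E T m N ->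
  covering_family S E T (m * r.+1) (N ^ r.+1).
Proof.
move=> hE TS HN; elim: r => [|r IH]; first by rewrite muln1 expn1.
by rewrite expnS mulnS addnC; exact: covering_familyM.
Qed.

Lemma covering_familyU S E T m N W : h @` E `<=` E -> T `<=` S ->
  covering_family S E T m.+1 N ->
  compact W -> W `<=` S -> S `<=` iter m.+1 h @` W -> h @` (W `&` T) `<=` E ->
  covering_family S E S m.+1 N.+1.
Proof.
move=> hE TS [A [C [cA CS Cd]]] Wc WS SW WT.
exists (option A), (fun o => if o is Some a then C a else W).
have WC a : iter m.+1 h @` (W `&` C a) `<=` E.
  move=> _ [x [Wx Cx] <-]; rewrite iterSr; apply: iter_stable => //.
  exists (h x) => //; apply: WT; exists x => //; split => //.
  by have [_ + _] := CS a; apply.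
split=> [|[a|]|[a|] [b|]] //; first by rewrite card_option cA.
- by have [? CT ?] := CS a; split => // x /CT /TS.
- by move=> /(Cd a b).
- by rewrite setIC.
Qed.

(** A final passage through [K] turns pieces that may touch into disjoint ones: a common point would
    be at time [m] both in [E] and in [K]. *)
Lemma covering_family_horseshoe S E m N K p : compact S -> S p -> h p = p ->
  covering_family S E S m N ->
  compact K -> K `<=` S -> S `<=` h @` K -> K `&` E `<=` set0 ->
  horseshoe h m.+1 N.
Proof.
move=> Sc Sp hp [A [C [cA CS Cd]]] Kc KS SK KE.
exists A, (fun a => C a `&` iter m h @^-1` K), S, p; split=> //.
- move=> a; have [Cc CT SC] := CS a; split.
  + exact: compactI_preimage_iter.
  + by move=> x [/CT].
  + move=> y /SK[z Kz <-]; have [x Cx xz] := SC _ (KS _ Kz).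
    by exists x; [split; rewrite //= xz|rewrite iterS xz].
- move=> a b ab; apply/seteqP; split => // x [[Cx Kx] [Cbx _]].
  by apply: (KE (iter m h x)); split => //; apply: (Cd _ _ ab); exists x.
- by split => //; elim: m.+1 => //= n ->.
Qed.

Lemma three_covers_and_return S E T (A : finType) (C : A -> set R) i0 W k p :
  #|A| = 3%N -> compact S -> S p -> h p = p -> h @` E `<=` E -> T `<=` S ->
  (forall i, [/\ compact (C i), C i `<=` T & S `<=` h @` C i]) ->
  (forall i j, i != j -> h @` (C i `&` C j) `<=` E) ->
  C i0 `&` E `<=` set0 ->
  compact W -> W `<=` S -> S `<=` iter k.+1 h @` W -> h @` (W `&` T) `<=` E ->
  exists m N, [/\ (0 < m)%N, (3 ^ m < N)%N & horseshoe h m N].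
Proof.
move=> cA Sc Sp hp hE TS CS Cd CE Wc WS SW WT.
have H3 : covering_family S E T 1 3 by exists A, C.
have := covering_familyX S E T 1 3 k hE TS H3; rewrite mul1n => H3k.
have Hk := covering_familyU S E T k (3 ^ k.+1) W hE TS H3k Wc WS SW WT.
(* The final passage through [C i0] costs a factor 3 in the comparison. With this [r],
   [3 * a ^ r.+1 = r * a ^ r], which is below the second binomial term [r.+1 * a ^ r] of
   [a.+1 ^ r.+1]. *)
pose a := (3 ^ k.+1)%N; pose r := (3 * a)%N.
have Hr := covering_familyX S E S k.+1 a.+1 r hE (@subset_refl _ S) Hk.
exists (k.+1 * r.+1).+1, (a.+1 ^ r.+1)%N; split => //.
  rewrite expnS expnM -/a.
  have bern n : (a ^ n.+1 + n.+1 * a ^ n <= a.+1 ^ n.+1)%N.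
    elim: n => [|n IH]; first by rewrite !expn1 expn0; lia.
    rewrite (expnS a.+1).
    apply: leq_trans (_ : a.+1 * (a ^ n.+1 + n.+1 * a ^ n) <= _)%N; last first.
      by rewrite leq_mul2l IH orbT.
    by rewrite !expnS; nia.
  apply: leq_trans (bern r); rewrite /r.
  have : (0 < a ^ r)%N by rewrite expn_gt0 /a expn_gt0.
  by rewrite -/r expnS {3}/r; nia.
have [Cc CT SC] := CS i0.
by apply: (covering_family_horseshoe S E _ _ (C i0) p) => // x /CT /TS.
Qed.

End Chains.

(** * Laps of a map of a half-line *)

Section Line.
Context {R : realType}.
Implicit Types (f g : R -> R) (A : set R).

Lemma ivt_up f a b v : continuous f -> a <= b -> f a <= v <= f b ->
  exists2 c, a <= c <= b & f c = v.
Proof.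
move=> fc ab /andP[av vb].
have [||c + <-] := @IVT R f a b v ab; first exact: continuous_subspaceT.
  by rewrite ge_min le_max av vb orbT.
by rewrite in_itv /= => cab; exists c.
Qed.

Lemma ivt_down f a b v : continuous f -> a <= b -> f b <= v <= f a ->
  exists2 c, a <= c <= b & f c = v.
Proof.
move=> fc ab /andP[av vb].
have [||c + <-] := @IVT R f a b v ab; first exact: continuous_subspaceT.
  by rewrite ge_min le_max av vb orbT.
by rewrite in_itv /= => cab; exists c.
Qed.

Lemma argmax_itv f a b : continuous f -> a <= b ->
  exists2 c, a <= c <= b & forall t, a <= t <= b -> f t <= f c.
Proof.
move=> fc ab; have [|c + H] := @EVT_max R f a b ab; first exact: continuous_subspaceT.
by rewrite in_itv /= => cab; exists c => // t tab; apply: H; rewrite in_itv.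
Qed.

Lemma argmin_itv f a b : continuous f -> a <= b ->
  exists2 c, a <= c <= b & forall t, a <= t <= b -> f c <= f t.
Proof.
move=> fc ab; have [|c + H] := @EVT_min R f a b ab; first exact: continuous_subspaceT.
by rewrite in_itv /= => cab; exists c => // t tab; apply: H; rewrite in_itv.
Qed.

Lemma last_zero f a b : continuous f -> a <= b -> f a <= 0 -> 0 < f b ->
  exists2 p, a <= p < b & f p = 0 /\ forall t, p < t <= b -> 0 < f t.
Proof.
move=> fc ab fa fb.
pose Z := `[a, b] `&` f @^-1` [set u | u <= 0].
have Za : Z a by split; rewrite /= ?in_itv /= ?lexx ?ab.
have Zc : closed Z.
  apply: closedI; first exact: interval_closed.
  by apply: preimage_closed; [move=> x _; exact: fc | exact: closed_le].
have Zb : ubound Z b by move=> x [/=]; rewrite in_itv /= => /andP[].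
have [pab fp] : Z (sup Z).
  have : closure Z (sup Z).
    by move=> B; apply: (closure_sup (A := Z)); [exists a | exists b].
  by rewrite -(iffLR (closure_id Z) Zc).
have {}fp : f (sup Z) <= 0 := fp.
have {}pab : a <= sup Z <= b by move: pab; rewrite /= in_itv.
have pos t : sup Z < t <= b -> 0 < f t.
  move=> /andP[pt tb]; rewrite ltNge; apply/negP => ft.
  move: (pt); rewrite ltNge => /negP; apply; apply: ub_le_sup; first by exists b.
  by split => //=; rewrite in_itv /= tb andbT; lra.
have pb : sup Z < b.
  rewrite lt_neqAle; case/andP: pab => _ ->; rewrite andbT.
  by apply/eqP => pb; move: fp; rewrite pb; lra.
exists (sup Z); first by lra.
split => //; have [c cpb fc0] := ivt_up f (sup Z) b 0 fc (ltW pb) ltac:(lra).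
have [->|pc] := eqVneq (sup Z) c; first exact: fc0.
have := pos c ltac:(lra); lra.
Qed.

Lemma first_zero f a b : continuous f -> a <= b -> f a < 0 -> 0 <= f b ->
  exists2 q, a < q <= b & f q = 0 /\ forall t, a <= t < q -> f t < 0.
Proof.
move=> fc ab fa fb.
have fc' : continuous (fun t => - f (- t)).
  move=> t; apply: cvgN; apply: continuous_comp; last exact: fc.
  exact: opp_continuous.
have [|||p pab [fp Hp]] := last_zero _ (- b) (- a) fc'; rewrite ?opprK; try lra.
exists (- p); first by lra.
split; first by lra.
move=> t tp; have := Hp (- t); rewrite opprK => /(_ ltac:(lra)); lra.
Qed.

(* The two hypotheses on [M] say that neither [c, M] nor [M, +oo[ is invariant,
   as for the half-line [c, +oo[ under a transitive map. *)
Lemma half_line_laps g c : continuous g ->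
  (forall M, c < M -> exists2 x, c <= x <= M & M < g x) ->
  (forall M, c < M -> exists2 y, M <= y & g y < M) ->
  exists p x y q, [/\ c < p /\ p < x, x < y /\ y < q, g p = p /\ q <= g x,
    g y = p /\ g q = q &
    (forall t, p < t <= x -> t < g t) /\ (forall t, y <= t < q -> g t < t)].
Proof.
move=> gc up down.
have gidc : continuous (fun t => g t - t).
  by move=> t; apply: cvgB; [exact: gc | exact: cvg_id].
have last_fix a b : a <= b -> g a <= a -> b < g b -> exists2 p, a <= p < b &
    g p = p /\ forall t, p < t <= b -> t < g t.
  move=> ab ga gb; have [||p pab [gp Hp]] := last_zero _ a b gidc ab; try lra.
  exists p => //; split; first by lra.
  by move=> t /Hp; lra.
have first_fix a b : a <= b -> g a < a -> b <= g b -> exists2 q, a < q <= b &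
    g q = q /\ forall t, a <= t < q -> g t < t.
  move=> ab ga gb; have [||q qab [gq Hq]] := first_zero _ a b gidc ab; try lra.
  exists q => //; split; first by lra.
  by move=> t /Hq; lra.
have [p1 cp1 gp1] : exists2 p, c < p & g p = p.
  have c1 : c < c + 1 by lra.
  have [x xc gx] := up _ c1; have [y yc gy] := down _ c1.
  have [||p pxy gp] := ivt_down _ x y 0 gidc; try lra.
  exists p; last by lra.
  have : x < p; last by lra.
  by rewrite lt_neqAle; apply/andP; split; [apply/eqP => xp; subst p; lra|lra].
have [m1 m1P Hm1] := argmax_itv g c p1 gc (ltW cp1).
have gm1 : p1 <= g m1 by rewrite -{1}gp1; apply: Hm1; lra.
(* Maximising up to [g m1] instead of [p1] pushes the maximum past [p1], while
   [x0 <= g m1 < g x0]. *)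
have [x0 x0P Hx0] := argmax_itv g c (g m1) gc ltac:(lra).
have gx0 : g m1 < g x0.
  have [t tP gt] := up (g m1) ltac:(lra); apply: lt_le_trans gt _; exact: Hx0.
have px0 : p1 < x0.
  by rewrite ltNge; apply/negP => xp; have := Hm1 x0 ltac:(lra); lra.
have [p0 p0P [gp0 Hp0]] := last_fix p1 x0 ltac:(lra) ltac:(lra) ltac:(lra).
have [y0 py0' gy0] := down p0 ltac:(lra).
have py0 : p0 < y0.
  by rewrite lt_neqAle py0' andbT; apply/eqP => e; subst y0; lra.
have xy0 : x0 < y0.
  by rewrite ltNge; apply/negP => yx; have := Hp0 y0 ltac:(lra); lra.
(* As [x0] is already maximal on [[c, x0]], this [x] is maximal on all of [[c, y0]]. *)
have [x xP Hx] := argmax_itv g x0 y0 gc ltac:(lra).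
have gxm t : c <= t <= y0 -> g t <= g x.
  move=> tP; have [tx|tx] := leP t x0; last by apply: Hx; lra.
  have := Hx x0 ltac:(lra); have := Hx0 t ltac:(lra); lra.
have gxy : y0 < g x.
  have [t tP gt] := up y0 ltac:(lra); have := gxm t tP; lra.
have [p pP [gp Hp]] := last_fix p0 x ltac:(lra) ltac:(lra) ltac:(lra).
have [y yP gy] := ivt_down g x y0 p gc ltac:(lra) ltac:(lra).
have xy : x < y.
  by rewrite lt_neqAle; apply/andP; split; [apply/eqP => xy; subst y; lra|lra].
(* Maximality of [g x] forces [t] beyond [y0], and [t <= g x] yields [q <= g x] for any fixed point
   [q <= t]. *)
have [t tP gt] := up (g x) ltac:(lra).
have yt : y0 < t by rewrite ltNge; apply/negP => ty; have := gxm t ltac:(lra); lra.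
have [q qP [gq Hq]] := first_fix y t ltac:(lra) ltac:(lra) ltac:(lra).
by exists p, x, y, q; split; (split || lra) => //; lra.
Qed.

End Line.

(** * Transitive maps *)

Section Transitive.
Context {R : realType} (f : R -> R).
Hypotheses (fc : continuous f) (ft : transitive_map f).
Implicit Types (A S : set R).

Lemma iter_visits (u v u' v' : R) : u < v -> u' < v' ->
  exists n t, [/\ (0 < n)%N, u < t < v & u' < iter n f t < v'].
Proof.
move=> uv uv'; have [||||n n0 [_ [[t tuv <-] tuv']]] :=
  ft `]u, v[%classic `]u', v'[%classic.
- exact: interval_open.
- exact: interval_open.
- by exists ((u + v) / 2); rewrite /= in_itv /=; lra.
- by exists ((u' + v') / 2); rewrite /= in_itv /=; lra.
by exists n, t; split.
Qed.

(** The iterates of []u, v[] stay in [A] and, by transitivity, meet every ball. *)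
Lemma invariant_full A (u v : R) : closed A -> (forall x, A x -> A (f x)) ->
  u < v -> (forall t, u < t < v -> A t) -> forall x, A x.
Proof.
move=> Ac fA uv uvA x.
have iA n t : A t -> A (iter n f t) by move=> At; elim: n => //= n; exact: fA.
rewrite (iffLR (closure_id A) Ac) => B /nbhs_ballP[r /= r0 rB].
have [n [t [_ tuv tx]]] := iter_visits u v (x - r) (x + r) uv ltac:(lra).
exists (iter n f t); split; first by apply: iA; exact: uvA.
by apply: rB; rewrite /ball /= ltr_distlC; lra.
Qed.

Lemma no_invariant_ge a : exists2 x, a <= x & f x < a.
Proof.
apply: contrapT => H; suff : a <= a - 1 by lra.
apply: (invariant_full [set x | a <= x] a (a + 1)) => /=; try lra.
- exact: closed_ge.
- by move=> x ax; rewrite leNgt; apply/negP => fx; apply: H; exists x.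
- by move=> t; lra.
Qed.

Lemma no_invariant_le a : exists2 x, x <= a & a < f x.
Proof.
apply: contrapT => H; suff : a + 1 <= a by lra.
apply: (invariant_full [set x | x <= a] (a - 1) a) => /=; try lra.
- exact: closed_le.
- by move=> x ax; rewrite leNgt; apply/negP => fx; apply: H; exists x.
- by move=> t; lra.
Qed.

Lemma no_invariant_itv a b : a < b ->
  exists2 x, a <= x <= b & ~~ (a <= f x <= b).
Proof.
move=> ab; apply: contrapT => H; suff : b + 1 <= b by lra.
suff : a <= b + 1 <= b by lra.
apply: (invariant_full [set x | a <= x <= b] a b) => //=; try lra.
- have -> : [set x | a <= x <= b] = `[a, b]%classic.
    by apply/seteqP; split => t; rewrite /= in_itv.
  exact: interval_closed.
- by move=> x axb; apply: contrapT => /negP fx; apply: H; exists x.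
- by move=> t; lra.
Qed.

Lemma two_horseshoe p z : f p = p -> p < z ->
  (forall t, p < t <= z -> t < f t) ->
  horseshoe f 1 2.
Proof.
move=> fp pz Hz; have [y py fy] := no_invariant_ge p.
have zy : z < y.
  rewrite ltNge; apply/negP => yz; have := Hz y.
  have [yp|] := eqVneq y p; first by move: fy; rewrite yp; lra.
  by move=> ?; lra.
have fpc : continuous (fun t => p - f t).
  by move=> t; apply: cvgB; [exact: cvg_cst | exact: fc].
have [||q qP [fq Hq]] := first_zero _ z y fpc (ltW zy).
- by have := Hz z ltac:(lra); lra.
- lra.
have fge t : p <= t <= q -> p <= f t.
  move=> tP; have [tz|tz] := leP t z.
    have [->|tp] := eqVneq t p; first by rewrite fp.
    have pt : p < t by rewrite lt_neqAle eq_sym tp; lra.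
    by have := Hz t ltac:(lra); lra.
  have [->|tq] := eqVneq t q; first by lra.
  have tq' : t < q by rewrite lt_neqAle tq; lra.
  by have := Hq t ltac:(lra); lra.
(* Since [f >= p] on [[p, q]], a point can leave this interval only above [q]. The strict inequality
   [q < f m] keeps the two preimages [x1], [x2] of [q] on opposite sides of [m]. *)
have [m mP fm] : exists2 m, p <= m <= q & q < f m.
  have [m mP] := no_invariant_itv p q ltac:(lra).
  by rewrite fge //= -ltNge => qfm; exists m.
have [x1 x1P fx1] := ivt_up f p m q fc ltac:(lra) ltac:(lra).
have [x2 x2P fx2] := ivt_down f m q q fc ltac:(lra) ltac:(lra).
have x1m : x1 < m.
  by rewrite lt_neqAle; apply/andP; split; [apply/eqP => e; subst m|]; lra.
have x2m : m < x2.
  by rewrite lt_neqAle; apply/andP; split; [apply/eqP => e; subst m|]; lra.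
exists bool, (fun b => if b then `[p, x1]%classic else `[x2, q]%classic),
  `[p, q]%classic, p; split.
- by rewrite card_bool.
- case; split; try exact: segment_compact;
    move=> t; rewrite /= !in_itv /= => tP; try lra.
    by have [u uP <-] := ivt_up f p x1 t fc ltac:(lra) ltac:(lra);
       exists u; rewrite //= in_itv.
  by have [u uP <-] := ivt_down f x2 q t fc ltac:(lra) ltac:(lra);
     exists u; rewrite //= in_itv.
- by case; case => // _; apply/seteqP; split => // t; rewrite /= !in_itv /=; lra.
- by split; [exact: segment_compact | rewrite /= in_itv /= lexx; lra|].
Qed.

(** Without a 2-horseshoe, [f t <= t] to the right of every fixed point. Take for [c] the first
    fixed point after some [x] with [x < f x]: a point [t < x] with [f t < t] would give a fixed
    point between [t] and [x], hence [f x <= x]. *)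
Lemma central_fixed_point : ~ horseshoe f 1 2 ->
  exists c, [/\ f c = c, forall t, c <= t -> f t <= t &
                forall t, t <= c -> t <= f t].
Proof.
move=> nh.
have idc : continuous (fun t => f t - t).
  by move=> t; apply: cvgB; [exact: fc | exact: cvg_id].
have idc' : continuous (fun t => t - f t).
  by move=> t; apply: cvgB; [exact: cvg_id | exact: fc].
have right_of p t : f p = p -> p <= t -> f t <= t.
  move=> fp pt; rewrite leNgt; apply/negP => tf; apply: nh.
  have [||q qP [fq Hq]] := last_zero _ p t idc pt; try lra.
  apply: (two_horseshoe q t); try lra.
  by move=> u /Hq; lra.
have [y y0 fy] := no_invariant_ge 0; have [x x0 fx] := no_invariant_le 0.
have [||p pP fp] := ivt_down _ x y 0 idc; try lra.
have xp : x <= p by lra.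
have [||c cP [fcc Hc]] := first_zero _ x p idc' xp; try lra.
exists c; split => [|t ct|t tc]; first by lra.
  by apply: (right_of c) => //; lra.
have [tx|xt] := leP x t.
  have [->|tc'] := eqVneq t c; first by lra.
  have tc2 : t < c by rewrite lt_neqAle tc' tc.
  by have := Hc t ltac:(lra); lra.
rewrite leNgt; apply/negP => ftt.
have [||q qP fq] := ivt_up _ t x 0 idc; try lra.
have := right_of q x ltac:(lra) ltac:(lra); lra.
Qed.

End Transitive.

(** * The folded square *)

Section Folding.
Context {R : realType} (f : R -> R) (c : R).
Hypotheses (fc : continuous f) (ft : transitive_map f) (fcc : f c = c).
Hypotheses (right_le : forall t, c <= t -> f t <= t).
Hypotheses (left_ge : forall t, t <= c -> t <= f t).

Let h t := f (f t).

(* For [t >= c], this is the square of the map [t |-> min (f t) c] on the right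
   of [c] and [t |-> max (f t) c] on the left. *)
Definition folded_square t := Num.max (f (Num.min (f t) c)) c.

Local Notation g := folded_square.

(** If the inner cut-off were active, the value would be [f c = c]; above [c] neither cut-off
    acts. *)
Lemma folded_squareE t : c < g t -> f t < c /\ h t = g t.
Proof.
rewrite /g /h; case: (ltP (f t) c) => [fct|_]; last by rewrite fcc maxxx ltxx.
by rewrite lt_max ltxx orbF => cf; split => //; rewrite max_l // ltW.
Qed.

Lemma continuous_folded_square : continuous g.
Proof.
have idc : continuous (fun t : R => Num.min t c).
  move=> t; apply: (@continuous_min R R id (cst c) t); [exact: cvg_id|exact: cvg_cst].
have idC : continuous (fun t : R => Num.max t c).
  move=> t; apply: (@continuous_max R R id (cst c) t); [exact: cvg_id|exact: cvg_cst].
have mc : continuous (fun t => Num.min (f t) c).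
  move=> t; apply: (@continuous_comp _ _ _ f (fun u => Num.min u c)).
    exact: fc.
  exact: idc.
have fmc : continuous (fun t => f (Num.min (f t) c)).
  move=> t; apply: (@continuous_comp _ _ _ (fun t => Num.min (f t) c) f).
    exact: mc.
  exact: fc.
move=> t; apply: (@continuous_comp _ _ _ (fun t => f (Num.min (f t) c))
  (fun u => Num.max u c)); [exact: fmc|exact: idC].
Qed.

Lemma continuous_square : continuous h.
Proof. by move=> t; apply: continuous_comp; exact: fc. Qed.

(** Otherwise [[f a, M]] would be invariant under [f], where [f a] is the minimum of [f] on
    [[c, M]]: a point of [[f a, c[] is [f s] for some [s] in [[c, M]], so its image is at most
    [g s <= M]. *)
Lemma folded_square_up M : c < M -> exists2 x, c <= x <= M & M < g x.
Proof.
move=> cM; apply: contrapT => H.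
have gM x : c <= x <= M -> g x <= M.
  by move=> xP; rewrite leNgt; apply/negP => gx; apply: H; exists x.
have [a aP Ha] := argmin_itv f c M fc (ltW cM).
have fac : f a <= c by rewrite -[leRHS]fcc; apply: Ha; lra.
have [x xP /negP[]] := no_invariant_itv f ft (f a) M ltac:(lra).
have [cx|xc] := leP c x.
  by have := right_le x cx; have := Ha x ltac:(lra); lra.
have := left_ge x (ltW xc).
have [s sP fs] := ivt_down f c a x fc ltac:(lra) ltac:(rewrite fcc; lra).
have := gM s ltac:(lra); rewrite /g fs min_l ?(ltW xc)// ge_max; lra.
Qed.

(** If [g] preserved the ray, then the ray together with its preimage left of [c] would be closed
    and [f]-invariant, yet miss the middle of []c, M[]. The same construction handles segments in
    [folded_square_leaves]. *)
Lemma folded_square_down M : c < M -> exists2 y, M <= y & g y < M.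
Proof.
move=> cM; apply: contrapT => H.
have gM y : M <= y -> M <= g y.
  by move=> My; rewrite leNgt; apply/negP => gy; apply: H; exists y.
pose A := [set t | M <= t] `|` ([set t | t <= c] `&` f @^-1` [set t | M <= t]).
suff : A ((c + M) / 2) by case=> [/=|[/=]]; lra.
apply: (invariant_full f ft A M (M + 1)); last 2 first.
- lra.
- by move=> t tM; left => /=; lra.
- apply: closedU; first exact: closed_ge.
  apply: closedI; first exact: closed_le.
  by apply: preimage_closed; [move=> t _; exact: fc | exact: closed_ge].
move=> t [/gM Mt|[_ Mt]]; last by left; exact: Mt.
have [ftc ht] := folded_squareE t ltac:(lra).
by right; split; [exact: ltW | move: Mt; rewrite -ht].
Qed.

Lemma folded_square_leaves a b : c < a -> a < b ->
  exists2 x, a <= x <= b & ~~ (a <= g x <= b).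
Proof.
move=> ca ab; apply: contrapT => H.
have gI x : a <= x <= b -> a <= g x <= b.
  by move=> xP; apply: contrapT => /negP gx; apply: H; exists x.
pose A := `[a, b]%classic `|` ([set t | t <= c] `&` f @^-1` `[a, b]%classic).
suff : A ((c + a) / 2) by case=> [/=|[/=]]; rewrite ?in_itv /=; lra.
apply: (invariant_full f ft A a b) => //.
- apply: closedU; first exact: interval_closed.
  apply: closedI; first exact: closed_le.
  by apply: preimage_closed; [move=> t _; exact: fc | exact: interval_closed].
- move=> t [|[_ Mt]]; last by left; exact: Mt.
  rewrite /= in_itv /= => tP; have gt := gI _ tP.
  have [ftc ht] := folded_squareE t ltac:(lra).
  by right; split; [exact: ltW | rewrite /= in_itv /= -/(h t) ht].
- by move=> t tab; left; rewrite /= in_itv /=; lra.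
Qed.

(** * Expansion of one-sided neighbourhoods of fixed points of the square *)

Lemma iter_square n t : iter n h t = iter n.*2 f t.
Proof. by elim: n => //= n ->. Qed.

Lemma itv_value (phi : R -> R) a b s t w : continuous phi ->
  a <= s <= b -> a <= t <= b -> phi s <= w <= phi t ->
  exists2 u, a <= u <= b & phi u = w.
Proof.
move=> pc sP tP wP; have [st|ts] := leP s t.
  by have [u uP <-] := ivt_up phi s t w pc st wP; exists u => //; lra.
by have [u uP <-] := ivt_down phi t s w pc (ltW ts) wP; exists u => //; lra.
Qed.

Let hnc n : continuous (iter n h).
Proof. exact: continuous_iter continuous_square. Qed.

Let fhnc n : continuous (fun t => f (iter n h t)).
Proof. by move=> t; apply: continuous_comp; [exact: hnc | exact: fc]. Qed.

Lemma iter_square_odd n t : iter n.*2.+1 f t = f (iter n h t).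
Proof. by rewrite iterS iter_square. Qed.

(* An odd iterate of f sends [p] to the left of [c], so as soon as it also
   takes values to the right of [c] it takes the fixed value [c]. *)
Lemma square_reaches_center a b p n t : h p = p -> f p < c -> a <= p <= b ->
  a <= t <= b -> c < f (iter n h t) ->
  exists2 u, a <= u <= b & f (iter n h u) = c.
Proof.
move=> hp fp pP tP cf; have iterp : iter n h p = p by elim: n {cf} => //= n ->.
by apply: (itv_value _ a b p t c (fhnc n) pP tP); rewrite /= iterp; lra.
Qed.

(** If iterates of [h] kept [[a, p]] below [p], any iterate of [f] leading from it beyond [p] would
    be odd, so some iterate of [h] would take the value [c] on [[a, p]]. A second transit starts at
    [v] in []c, p[]; [v] is reached by [f (iter n h w)] or by [iter n.+1 h w], whichever makes the
    total number of steps even. *)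
Lemma square_crosses_right a p : c < a -> a < p -> h p = p -> f p < c ->
  exists n t, a <= t <= p /\ p < iter n h t.
Proof.
move=> ca ap hp fp; apply: contrapT => H.
have Hle n t : a <= t <= p -> iter n h t <= p.
  by move=> tP; rewrite leNgt; apply/negP => lt; apply: H; exists n, t.
have iterp n : iter n h p = p by elim: n => //= n ->.
have [N [t [_ tP tN]]] := iter_visits f ft a p p (p + 1) ap ltac:(lra).
have oddN : odd N.
  apply: contraT => /negPf evenN; have := odd_double_half N.
  rewrite evenN add0n => NE; have := Hle N./2 t ltac:(lra).
  by rewrite iter_square NE; lra.
pose n := N./2; have NE : N = n.*2.+1 by rewrite -[LHS]odd_double_half oddN.
have {tN} tn : p < f (iter n h t) by rewrite -iter_square_odd -NE; lra.
have [u uP fu] := square_reaches_center a p p n t hp fp ltac:(lra) ltac:(lra) ltac:(lra).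
have hu : iter n.+1 h u = c by rewrite iterS /h fu fcc.
have [M [v [_ vP vM]]] := iter_visits f ft c p p (p + 1) ltac:(lra) ltac:(lra).
have ME := odd_double_half M.
have [oddM|evenM] := boolP (odd M).
  have [w wP fw] := itv_value _ a p p t v (fhnc n) ltac:(lra) ltac:(lra)
    ltac:(rewrite /= iterp; lra).
  have := Hle (M./2.+1 + n)%N w wP; rewrite iterD iterSr {2}/h fw.
  rewrite iter_square -iterSr -add1n.
  by move: ME; rewrite oddM => ->; lra.
have [w wP fw] := itv_value _ a p u p v (hnc n.+1) ltac:(lra) ltac:(lra)
  ltac:(rewrite hu iterp; lra).
have := Hle (M./2 + n.+1)%N w wP; rewrite iterD fw iter_square.
by move: ME; rewrite (negPf evenM) add0n => ->; lra.
Qed.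

(** One transit is enough on this side: reaching [c] already means falling below [q]. *)
Lemma square_crosses_left q b : c < q -> q < b -> h q = q -> f q < c ->
  exists n t, q <= t <= b /\ iter n h t < q.
Proof.
move=> cq qb hq fq; apply: contrapT => H.
have Hle n t : q <= t <= b -> q <= iter n h t.
  by move=> tP; rewrite leNgt; apply/negP => lt; apply: H; exists n, t.
have [N [t [_ tP tN]]] := iter_visits f ft q b c q qb cq.
have oddN : odd N.
  apply: contraT => /negPf evenN; have := odd_double_half N.
  rewrite evenN add0n => NE; have := Hle N./2 t ltac:(lra).
  by rewrite iter_square NE; lra.
pose n := N./2; have NE : N = n.*2.+1 by rewrite -[LHS]odd_double_half oddN.
have {tN} tn : c < f (iter n h t) by rewrite -iter_square_odd -NE; lra.
have [u uP fu] := square_reaches_center q b q n t hq fq ltac:(lra) ltac:(lra) ltac:(lra).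
by have := Hle n.+1 u uP; rewrite iterS /h fu fcc; lra.
Qed.

(** Once an iterate of [[a, p]] passes [x], it covers [[p, x]], and one more step covers [[p, q]].
    Otherwise the union [D] of the iterates has its supremum in []p, x]], where [g] moves points to
    the right, so [D] would contain points beyond it. *)
Lemma square_expands_left a p x q : c < a -> a < p -> p < x -> g p = p ->
  q <= g x -> (forall t, p < t <= x -> t < g t) ->
  exists n, forall w, p <= w <= q -> exists2 t, a <= t <= p & iter n h t = w.
Proof.
move=> ca ap px gp qx Hg.
have [fp hp] := folded_squareE p ltac:(lra); rewrite gp in hp.
have iterp n : iter n h p = p by elim: n => //= n ->.
pose D := [set v | exists n t, a <= t <= p /\ iter n h t = v].
have [[n [t [tP xt]]]|H] := pselect (exists n t, a <= t <= p /\ x <= iter n h t).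
  exists n.+1 => w wP.
  have [s sP gs] := ivt_up g p x w continuous_folded_square ltac:(lra) ltac:(lra).
  have [u uP us] := itv_value _ a p p t s (hnc n) ltac:(lra) ltac:(lra)
    ltac:(rewrite iterp; lra).
  exists u => //; rewrite iterS us; have [_ ->] := folded_squareE s ltac:(lra).
  exact: gs.
have Dx v : D v -> v < x.
  move=> [n [t [tP <-]]]; rewrite ltNge; apply/negP => xt.
  by apply: H; exists n, t.
have [n [t [tP pt]]] := square_crosses_right a p ca ap hp fp.
have Dub : has_ubound D by exists x => v /Dx /ltW.
have Dt : D (iter n h t) by exists n, t.
have ts := ub_le_sup Dub Dt.
have sx : sup D <= x by apply: ge_sup; [exists (iter n h t) | move=> v /Dx /ltW].
have gs := Hg (sup D) ltac:(lra).
have /nbhs_ballP[e /= e0 He] : \forall u \near sup D, sup D < g u.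
  exact: (cvgr_gt _ (continuous_folded_square _) _ gs).
have [v Dv vs] : exists2 v, D v & sup D - e < v.
  by apply: sup_adherent => //; split => //; exists (iter n h t).
have vle := ub_le_sup Dub Dv.
have gv : sup D < g v by apply: He; rewrite /ball /= ger0_norm; lra.
have [_ hv] := folded_squareE v ltac:(lra).
have Dgv : D (g v).
  by move: Dv => [k [u [uP uv]]]; exists k.+1, u; rewrite iterS uv.
by have := ub_le_sup Dub Dgv; lra.
Qed.

Lemma square_expands_right p y q b : c < p -> p < y -> y < q -> q < b ->
  g y = p -> g q = q -> (forall t, y <= t < q -> g t < t) ->
  exists n, forall w, p <= w <= q -> exists2 t, q <= t <= b & iter n h t = w.
Proof.
move=> cp py yq qb gy gq Hg.
have [fq hq] := folded_squareE q ltac:(lra); rewrite gq in hq.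
have iterq n : iter n h q = q by elim: n => //= n ->.
pose D := [set v | exists n t, q <= t <= b /\ iter n h t = v].
have [[n [t [tP xt]]]|H] := pselect (exists n t, q <= t <= b /\ iter n h t <= y).
  exists n.+1 => w wP.
  have [s sP gs] := ivt_up g y q w continuous_folded_square ltac:(lra) ltac:(lra).
  have [u uP us] := itv_value _ q b t q s (hnc n) ltac:(lra) ltac:(lra)
    ltac:(rewrite iterq; lra).
  exists u => //; rewrite iterS us; have [_ ->] := folded_squareE s ltac:(lra).
  exact: gs.
have Dx v : D v -> y < v.
  move=> [n [t [tP <-]]]; rewrite ltNge; apply/negP => xt.
  by apply: H; exists n, t.
have [n [t [tP pt]]] := square_crosses_left q b ltac:(lra) qb hq fq.
have Dlb : has_lbound D by exists y => v /Dx /ltW.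
have Dt : D (iter n h t) by exists n, t.
have ts := ge_inf Dlb Dt.
have sx : y <= inf D by apply: lb_le_inf; [exists (iter n h t) | move=> v /Dx /ltW].
have gs := Hg (inf D) ltac:(lra).
have /nbhs_ballP[e /= e0 He] : \forall u \near inf D, g u < inf D.
  exact: (cvgr_lt _ (continuous_folded_square _) _ gs).
have [v Dv] : exists2 v, D v & v < inf D + Num.min e (q - inf D).
  apply: inf_adherent; first by rewrite lt_min e0; lra.
  by split => //; exists (iter n h t).
rewrite -ltrBlDl lt_min => vs.
have vge := ge_inf Dlb Dv.
have gv : g v < inf D by apply: He; rewrite /ball /= ler0_norm; lra.
(* [g v] may be cut off at [c], where [h] can differ from [g]. A value [w > c] still below [inf D]
   is therefore taken at some [s] between [v] and [q]. *)
pose w := (Num.max (g v) c + inf D) / 2.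
have wP : Num.max (g v) c < w < inf D.
  have : Num.max (g v) c < inf D by rewrite gt_max gv; lra.
  by rewrite /w; lra.
move: wP; rewrite gt_max => wP.
have [s sP gsw] := ivt_up g v q w continuous_folded_square ltac:(lra) ltac:(lra).
have [_ hs] := folded_squareE s ltac:(lra).
move: Dv => [k [u [uP uv]]].
have [r rP rs] := itv_value _ q b u q s (hnc k) ltac:(lra) ltac:(lra)
  ltac:(rewrite uv iterq; lra).
have Dw : D w by exists k.+1, r; rewrite iterS rs hs.
by have := ge_inf Dlb Dw; lra.
Qed.


(** The laps [[p, r0]], [[l1, r1]], [[l2, q]] are restricted to points with [g] in [[p, q]], where
    [g] is [h]. Neighbouring laps can touch only at a turning point, where [g >= q] or [g <= p], so
    the restricted value is an endpoint. A gap between laps leaves room for [W]. *)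
Lemma three_laps_and_return p r0 l1 r1 l2 q k (W : set R) :
  c < p -> p < r0 -> r0 <= l1 -> l1 < r1 -> r1 <= l2 -> l2 < q ->
  g p = p -> q <= g r0 -> q <= g l1 -> g r1 <= p -> g l2 <= p -> g q = q ->
  compact W -> (forall t, W t -> p <= t <= q) ->
  (forall w, p <= w <= q -> exists2 t, W t & iter k.+1 h t = w) ->
  (forall t, W t -> [\/ t <= r0, l1 <= t <= r1 | l2 <= t] ->
    h t = p \/ h t = q) ->
  exists m N, [/\ (0 < m)%N, (3 ^ m < N)%N & horseshoe h m N].
Proof.
move=> cp pr0 rl0 lr1 rl1 lq gp gr0 gl1 gr1 gl2 gq Wc WS SW WE.
have gc := continuous_folded_square.
have [_ hp] := folded_squareE p ltac:(lra); rewrite gp in hp.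
have [_ hq] := folded_squareE q ltac:(lra); rewrite gq in hq.
pose lap (o : option bool) :=
  if o is Some b then if b then (p, r0) else (l2, q) else (l1, r1).
pose C o := `[(lap o).1, (lap o).2]%classic `&` g @^-1` `[p, q]%classic.
have CP o t : C o t -> (lap o).1 <= t <= (lap o).2 /\ p <= g t <= q.
  by case=> /=; rewrite !in_itv.
have hg o t : C o t -> h t = g t.
  by move=> /CP[_ gt]; have [] := folded_squareE t ltac:(lra).
have Ccov o w : p <= w <= q -> exists2 t, C o t & h t = w.
  move=> wP; have [t tP gt] : exists2 t, (lap o).1 <= t <= (lap o).2 & g t = w.
    case: o => [[]|] /=.
    - by apply: ivt_up => //; lra.
    - by apply: ivt_up => //; lra.
    - by apply: ivt_down => //; lra.
  have Ct : C o t by split; rewrite /= in_itv //= gt.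
  by exists t => //; rewrite (hg o).
have Cpq o t : C o t -> p <= t <= q.
  by move=> /CP[+ _]; case: o => [[]|] /=; lra.
have SE t : `[p, q]%classic t -> p <= t <= q by rewrite /= in_itv.
pose E := [set t | t = p \/ t = q].
have CE t : r0 <= t <= l1 \/ r1 <= t <= l2 -> p <= g t <= q ->
    forall o o', o != o' -> C o t -> C o' t -> E (g t).
  move=> + gt; move=> [] tP o o' oo /CP[to _] /CP[to' _].
  - right; have [e|e] : t = r0 \/ t = l1.
      clear -pr0 rl0 lr1 rl1 lq tP oo to to'.
      by case: o o' oo to to' => [[]|] [[]|] //= _; lra.
    + by subst t; lra.
    + by subst t; lra.
  - left; have [e|e] : t = r1 \/ t = l2.
      clear -pr0 rl0 lr1 rl1 lq tP oo to to'.
      by case: o o' oo to to' => [[]|] [[]|] //= _; lra.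
    + by subst t; lra.
    + by subst t; lra.
(* The middle lap [C None] avoids both [p] and [q], so it can serve as the separating last step. *)
apply: (three_covers_and_return h continuous_square `[p, q]%classic E
  (\bigcup_o C o) (option bool) C None W k p) => //.
- by rewrite card_option card_bool.
- exact: segment_compact.
- by rewrite /= in_itv /= lexx; lra.
- by move=> _ [t [->|->] <-]; [left|right].
- by move=> t [j _ /Cpq]; rewrite /= in_itv.
- move=> o; split.
  + apply: compact_closedI; first exact: segment_compact.
    by apply: preimage_closed; [move=> t _; exact: gc|exact: interval_closed].
  + by move=> t Ct; exists o.
  + by move=> w /SE /(Ccov o)[t Ct <-]; exists t.
- move=> o o' oo _ [t [Ct Ct'] <-]; rewrite (hg o) //.
  apply: (CE t _ _ o o') => //; last by have [] := CP _ _ Ct.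
  have [to _] := CP _ _ Ct; have [to' _] := CP _ _ Ct'.
  clear -pr0 rl0 lr1 rl1 lq oo to to'.
  by case: o o' oo to to' => [[]|] [[]|] //= _; lra.
- by move=> t [/CP[/= tP _]] [|]; lra.
- move=> _ [t [Wt [j _ /CP[to _]]] <-]; apply: WE => //.
  by case: j to => [[]|] /=; [constructor 1|constructor 3|constructor 2]; lra.
Qed.

Lemma horseshoe_square :
  exists m N, [/\ (0 < m)%N, (3 ^ m < N)%N & horseshoe h m N].
Proof.
have gc := continuous_folded_square.
have [p [x [y [q [[cp px] [xy yq] [gp gx] [gy gq] [Hp Hq]]]]]] :=
  half_line_laps g c gc folded_square_up folded_square_down.
have [z zP gz] := folded_square_leaves p q cp ltac:(lra).
have closed_pre (phi : R -> R) a b : continuous phi ->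
    closed (phi @^-1` `[a, b]%classic).
  move=> pc; apply: preimage_closed; first by move=> t _; exact: pc.
  exact: interval_closed.
have hk k : continuous (fun t => iter k h (g t)).
  move=> t; apply: (@continuous_comp _ _ _ g (iter k h)); first exact: gc.
  exact: hnc.
(* These points pass through [[a, b]] after one step; with [c < a] that step of [g] is a step of
   [h]. *)
pose W u v a b k := `[u, v]%classic `&` g @^-1` `[a, b]%classic `&`
  (fun t => iter k h (g t)) @^-1` `[p, q]%classic.
have Wc u v a b k : compact (W u v a b k).
  apply: compact_closedI; last exact: closed_pre.
  by apply: compact_closedI; [exact: segment_compact|exact: closed_pre].
have WP u v a b k t : W u v a b k t -> u <= t <= v /\ a <= g t <= b.
  by case=> -[]; rewrite /= !in_itv.
have Wcov u v a b k : c < a ->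
    (forall w, p <= w <= q -> exists2 t, a <= t <= b & iter k h t = w) ->
    (forall w, a <= w <= b -> exists2 t, u <= t <= v & g t = w) ->
    forall w, p <= w <= q -> exists2 t, W u v a b k t & iter k.+1 h t = w.
  move=> ca Hk Hg w wP; have [s sP sw] := Hk w wP; have [t tP ts] := Hg s sP.
  exists t; first by split; [split|]; rewrite /= in_itv //= ts ?sw.
  by have [_ ht] := folded_squareE t ltac:(lra); rewrite iterSr ht ts.
have gzpq : g z < p \/ q < g z.
  by have [|pz] := ltP (g z) p; [left | right; move: gz; rewrite pz -ltNge].
have zp : p < z.
  by rewrite lt_neqAle; apply/andP; split; [apply/eqP => e; subst z|]; lra.
have zq : z < q.
  by rewrite lt_neqAle; apply/andP; split; [apply/eqP => e; subst z|]; lra.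
case: gzpq => gzpq.
- have xz : x < z by rewrite ltNge; apply/negP => zx; have := Hp z; lra.
  have [y1 y1P gy1] := ivt_down g x z p gc ltac:(lra) ltac:(lra).
  have [y2 y2P gy2] := ivt_up g z q p gc ltac:(lra) ltac:(lra).
  have xy1 : x < y1.
    by rewrite lt_neqAle; apply/andP; split; [apply/eqP => e; subst x|]; lra.
  have zy2 : z < y2.
    by rewrite lt_neqAle; apply/andP; split; [apply/eqP => e; subst z|]; lra.
  have y2q : y2 < q.
    by rewrite lt_neqAle; apply/andP; split; [apply/eqP => e; subst q|]; lra.
  (* [g z] may equal [c]; raising it keeps [a > c], and [[a, p]] is still covered by [g] on
     [[y1, z]], which meets the laps only at [y1]. *)
  pose a := Num.max (g z) ((c + p) / 2).
  have : Num.max (g z) ((c + p) / 2) <= a by [].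
  have ap : a < p by rewrite gt_max gzpq; lra.
  rewrite ge_max => aP.
  have [k Hk] := square_expands_left a p x q ltac:(lra) ap px gp gx Hp.
  apply: (three_laps_and_return p x x y1 y2 q k (W y1 z a p k)) => //; try lra.
  + by move=> t /WP; lra.
  + apply: Wcov => // [|w wP]; first by lra.
    by apply: ivt_down => //; lra.
  + move=> t /WP[t1 t2] t3; have ty : t = y1 by case: t3; lra.
    by left; have [_ ->] := folded_squareE t ltac:(lra); rewrite ty.
- have zy : z < y by rewrite ltNge; apply/negP => yz; have := Hq z; lra.
  have [x1 x1P gx1] := ivt_up g p z q gc ltac:(lra) ltac:(lra).
  have [x2 x2P gx2] := ivt_down g z y q gc ltac:(lra) ltac:(lra).
  have px1 : p < x1.
    by rewrite lt_neqAle; apply/andP; split; [apply/eqP => e; subst x1|]; lra.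
  have zx2 : z < x2.
    by rewrite lt_neqAle; apply/andP; split; [apply/eqP => e; subst x2|]; lra.
  have x2y : x2 < y.
    by rewrite lt_neqAle; apply/andP; split; [apply/eqP => e; subst x2|]; lra.
  have [k Hk] := square_expands_right p y q (g z) cp ltac:(lra) yq gzpq gy gq Hq.
  apply: (three_laps_and_return p x1 x2 y y q k (W x1 z q (g z) k)) => //; try lra.
  + by move=> t /WP; lra.
  + apply: Wcov => // [|w wP]; first by lra.
    by apply: ivt_up => //; lra.
  + move=> t /WP[t1 t2] t3; have ty : t = x1 by case: t3; lra.
    by right; have [_ ->] := folded_squareE t ltac:(lra); rewrite ty.
Qed.

End Folding.

Lemma horseshoe_iter2 (R : realType) (f : R -> R) m N :
  horseshoe (fun t => f (f t)) m N -> horseshoe f m.*2 N.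
Proof.
have E n t : iter n (fun t => f (f t)) t = iter n.*2 f t by rewrite iter_square.
move=> [A [C [S [s [cA CS Cd [Sc Ss fs]]]]]]; exists A, C, S, s; split => //.
- move=> a; have [Cc CS' SC] := CS a; split => // w /SC[t Ct <-].
  by exists t => //; rewrite E.
- by split => //; rewrite -E.
Qed.

Theorem theorem10 (R : realType) (f : R -> R) (fc : continuous f)
    (ft : transitive_map f) :
  ((ln (Num.sqrt (3 : R)))%:E < ent f)%E.
Proof.
have [h2|/(central_fixed_point f fc ft)[c [fcc fr fl]]] := pselect (horseshoe f 1 2).
  (* A 2-horseshoe for [f] itself is enough because [3 < 2 ^ 2]. *)
  exact: (log_sqrt3_lt_ent f 1 2).
have [m [N [m0 mN /horseshoe_iter2 hN]]] := horseshoe_square f c fc ft fcc fr fl.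
apply: (log_sqrt3_lt_ent f m.*2 N) => //; first by rewrite double_gt0.
by rewrite -muln2 expnM ltn_exp2r.
Qed.
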